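(* Let $\alpha_i\ge 0$, $\beta_i>0$ ($1\le i\le 5$) be real numbers. For the network configuration $N/N^+$ with these parameters and total flow $Q>0$, the pseudo-paradox occurs if any one of the following conditions holds: (a) $0<Q\le\min\{-\alpha/\beta_{45},\,-\bar\alpha/\beta_4\}$; (b) $0<Q\le\min\{\alpha/\beta_{12},\,-\hat\alpha/\beta_2\}$; (c) $Q>\max\{\alpha/\beta_{12},\,-\alpha/\beta_{45}\}$ and $Q\mathcal B_1\ge\hat\alpha\beta_{14}+\bar\alpha\beta_{25}$; (d) $\mathcal B_1=0$, $\hat\alpha\beta_{14}+\bar\alpha\beta_{25}>0$ and $Q>\max\{\alpha/\beta_{12},\,-\alpha/\beta_{45},\,\mu_1,\,\mu_2\}$.
   Context: The network $N^+$ has nodes $a,b,c,d$ and directed links $(a,b),(b,d),(b,c),(a,c),(c,d)$ with travel times $\alpha_1+\beta_1f_{ab}$, $\alpha_2+\beta_2f_{bd}$, $\alpha_3+\beta_3f_{bc}$, $\alpha_4+\beta_4f_{ac}$, $\alpha_5+\beta_5f_{cd}$ respectively, where $f_{ij}\ge 0$ is the (real) flow on link $(i,j)$ and $\alpha_i\ge 0$, $\beta_i>0$. All traffic, of total amount $Q>0$ (real), goes from $a$ to $d$ along the paths $P_1=a-b-d$, $P_2=a-c-d$, $P_3=a-b-c-d$. The network $N$ is $N^+$ with the link $(b,c)$ removed, so its paths are $P_1,P_2$ only. A flow assigns a non-negative real amount to each path, with total $Q$; the flow on a link is the sum of the flows of the paths containing it; the travel time on a path is the sum of the travel times of its links. A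 path has vanishing flow if its path flow is $0$. A network is at equilibrium if all paths with non-vanishing flow have the same travel time, and every path with vanishing flow has travel time at least this common value. The equilibrium exists and is unique; its common travel time is denoted $T_{Eq}$ for $N$ and $T^+_{Eq}$ for $N^+$ (both are functions of $Q$). The pseudo-paradox is said to occur in $N/N^+$ if $T^+_{Eq}=T_{Eq}$ for an interval of values of $Q$ (as opposed to a single point); it occurs for a given $Q$ if $Q$ belongs to such a non-degenerate interval. Notation: $\alpha_{ij}=\alpha_i+\alpha_j$, $\beta_{ij}=\beta_i+\beta_j$, $\alpha=\alpha_{45}-\alpha_{12}$, $\bar\alpha=\alpha_4-\alpha_{13}$, $\hat\alpha=\alpha_2-\alpha_{35}$, $\mathcal B_1=\beta_1\beta_5-\beta_2\beta_4$, and $$\mu_1=\frac{\hat\alpha\beta_{14}-\alpha\beta_3}{\beta_3\beta_{45}+\beta_5\beta_{14}},\qquad \mu_2=\frac{\bar\alpha\beta_{25}+\alpha\beta_3}{\beta_1\beta_{25}+\beta_3\beta_{12}}.$$ *)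

(* Defs.v *)
From HB Require Import structures.
From mathcomp Require Import all_boot all_order all_algebra.
From mathcomp Require Import all_classical all_reals.

Set Implicit Arguments.
Unset Strict Implicit.
Unset Printing Implicit Defensive.

Import Order.TTheory GRing.Theory Num.Theory.

Local Open Scope ring_scope.

(* [xy] is the directed link (x, y) between nodes x, y among a, b, c, d. *)
Inductive link : Type := ab | bd | bc | ac | cd.

Definition nat_of_link (l : link) : nat :=
  match l with ab => 1 | bd => 2 | bc => 3 | ac => 4 | cd => 5 end.

Lemma nat_of_link_inj : injective nat_of_link.
Proof. by case; case. Qed.

HB.instance Definition _ := Equality.copy link (inj_type nat_of_link_inj).

(* A path is the list of its links; a network is given by the duplicate-free
   list of its paths from a to d. *)
Definition P1 : seq link := [:: ab; bd].
Definition P2 : seq link := [:: ac; cd].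
Definition P3 : seq link := [:: ab; bc; cd].

Definition Nplus : seq (seq link) := [:: P1; P2; P3].
Definition N : seq (seq link) := [seq p <- Nplus | bc \notin p].

Definition by_link (R : Type) (x1 x2 x3 x4 x5 : R) (l : link) : R :=
  match l with ab => x1 | bd => x2 | bc => x3 | ac => x4 | cd => x5 end.

Section Equilibrium.
Variables (R : realType) (alpha beta : link -> R).
Implicit Types (G : seq (seq link)) (h : seq link -> R).

(* [h p] is the flow on the path p; only its values on the paths of G matter. *)
Definition is_flow G (Q : R) h : Prop :=
  (forall p, p \in G -> 0 <= h p) /\ \sum_(p <- G) h p = Q.

Definition link_flow G h (l : link) : R := \sum_(p <- G | l \in p) h p.

Definition link_time G h (l : link) : R := alpha l + beta l * link_flow G h l.

Definition path_time G h (p : seq link) : R := \sum_(l <- p) link_time G h l.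

Definition is_equilibrium G (Q : R) h (T : R) : Prop :=
  is_flow G Q h /\
  forall p, p \in G ->
    (h p != 0 -> path_time G h p = T) /\ (h p = 0 -> T <= path_time G h p).

(* When 0 < Q and all beta are positive the equilibrium exists and is unique,
   so the default value 0 is irrelevant. *)
Definition T_Eq G (Q : R) : R :=
  xget 0 [set T | exists h, is_equilibrium G Q h T]%classic.

Definition pseudo_paradox_at (Q : R) : Prop :=
  exists I : interval R,
    [/\ Q \in I,
        exists q1 q2, [/\ q1 \in I, q2 \in I & q1 < q2] &
        forall q, q \in I -> 0 < q /\ T_Eq Nplus q = T_Eq N q].

End Equilibrium.

(* Main.v *)
(** The equilibrium time is unique: testing the path times of each of two
equilibria against the other's path flows and adding the two inequalities shows
that the sum of [beta l * (f l - g l) ^ 2] over the links is nonpositive, so the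
link flows agree, and then each common time is at most the other. It therefore
suffices to exhibit equilibria. In (a), (b) and (c) the equilibrium of [N]
remains one in [Nplus], because there the unused path a-b-c-d is not faster; this
persists on a half-open interval of total flows having [Q] as an endpoint. In (d)
all three paths are used in [Nplus]; the vanishing of [B1] means that
beta1 / beta2 = beta4 / beta5, and diverting flow to a-b-c-d then changes neither
the time on a-b-d nor that on a-c-d. *)

Require Import Defs.
From HB Require Import structures.
From mathcomp Require Import all_boot all_order all_algebra.
From mathcomp Require Import all_classical all_reals.
From mathcomp Require Import ring lra.

Set Implicit Arguments.
Unset Strict Implicit.
Unset Printing Implicit Defensive.

Import Order.TTheory GRing.Theory Num.Theory.

Local Open Scope ring_scope.

(** * Uniqueness of the equilibrium time *)

Section EquilibriumTime.
Variables (R : realType) (alpha beta : link -> R).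
Implicit Types (G : seq (seq link)) (h g : seq link -> R) (Q T : R).

Definition links : seq link := [:: ab; bd; bc; ac; cd].

Lemma sum_path (p : seq link) (t : link -> R) :
  uniq p -> \sum_(l <- p) t l = \sum_(l <- links | l \in p) t l.
Proof.
move=> up; rewrite -[RHS]big_filter; apply: perm_big; apply: uniq_perm => //.
  exact: filter_uniq.
by move=> l; rewrite mem_filter andbC; case: l.
Qed.

(** Double counting of the pairs of a path and a link on it; total times become sums over links,
    where the dependence on the flow is affine. *)
Lemma sum_path_flow G h (t : link -> R) : all uniq G ->
  \sum_(p <- G) h p * (\sum_(l <- p) t l) =
  \sum_(l <- links) t l * link_flow G h l.
Proof.
move=> /allP uG.
transitivity (\sum_(p <- G) \sum_(l <- links) if l \in p then t l * h p else 0).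
  apply: eq_big_seq => p pG; rewrite sum_path ?uG// big_mkcond mulr_sumr.
  by apply: eq_bigr => l _; case: ifP => _; rewrite ?mulr0// mulrC.
rewrite exchange_big; apply: eq_bigr => l _.
rewrite /link_flow [in RHS]big_mkcond mulr_sumr.
by apply: eq_bigr => p _; case: ifP; rewrite ?mulr0.
Qed.

Lemma equilibrium_total_time G Q h T : is_equilibrium alpha beta G Q h T ->
  \sum_(p <- G) h p * path_time alpha beta G h p = Q * T.
Proof.
move=> [[h0 <-] eqh]; rewrite mulr_suml; apply: eq_big_seq => p pG.
have [-> | hp] := eqVneq (h p) 0; first by rewrite !mul0r.
by rewrite (eqh p pG).1.
Qed.

(** No path time under [h] is below [T], whatever weight [g] gives it. As [Q * T] is also the total
    time of [h], this is the variational inequality of equilibrium. *)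
Lemma equilibrium_le_total_time G Q h g T :
  is_equilibrium alpha beta G Q h T -> is_flow G Q g ->
  Q * T <= \sum_(p <- G) g p * path_time alpha beta G h p.
Proof.
move=> [_ eqh] [g0 <-]; rewrite mulr_suml.
rewrite big_seq [leRHS]big_seq; apply: ler_sum => p pG.
apply: ler_wpM2l; first exact: g0.
have [hp | hp] := eqVneq (h p) 0; first exact: (eqh p pG).2.
by rewrite (eqh p pG).1.
Qed.

Lemma equilibrium_link_flow_unique G Q h g T U :
  (forall l, 0 < beta l) -> all uniq G ->
  is_equilibrium alpha beta G Q h T -> is_equilibrium alpha beta G Q g U ->
  link_flow G h =1 link_flow G g.
Proof.
move=> beta0 uG eh eg.
have := equilibrium_le_total_time eh eg.1.
have := equilibrium_le_total_time eg eh.1.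
rewrite -(equilibrium_total_time eh) -(equilibrium_total_time eg).
rewrite !sum_path_flow// => le1 le2.
(* Adding the two inequalities cancels the constants [alpha l]. *)
have sq0 : \sum_(l <- links) beta l * (link_flow G h l - link_flow G g l) ^+ 2 <= 0.
  move: (lerD le1 le2); rewrite -subr_ge0 -!big_split -sumrB => le0.
  rewrite -oppr_ge0 -sumrN; apply: le_trans le0 _.
  by rewrite le_eqVlt; apply/orP; left; apply/eqP; apply: eq_bigr => l _;
    rewrite /link_time/=; ring.
have term0 l : 0 <= beta l * (link_flow G h l - link_flow G g l) ^+ 2.
  by rewrite mulr_ge0 ?sqr_ge0// ltW.
have /eqP := le_anti (introT andP (conj sq0 (sumr_ge0 _ (fun l _ => term0 l)))).
rewrite psumr_eq0// => /allP flow0 l.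
have /flow0/= : l \in links by case: l.
by rewrite mulf_eq0 gt_eqF//= sqrf_eq0 subr_eq0 => /eqP.
Qed.

(** At the link times of [h], the flow [g] costs at least [Q * T]; since the link flows agree, this
    cost is [Q * U]. *)
Lemma equilibrium_time_le G Q h g T U :
  (forall l, 0 < beta l) -> all uniq G -> 0 < Q ->
  is_equilibrium alpha beta G Q h T -> is_equilibrium alpha beta G Q g U ->
  T <= U.
Proof.
move=> beta0 uG Q0 eh eg; rewrite -(ler_pM2l Q0).
apply: le_trans (equilibrium_le_total_time eh eg.1) _.
rewrite -(equilibrium_total_time eg) le_eqVlt; apply/orP; left; apply/eqP.
apply: eq_bigr => p _; congr (_ * _); apply: eq_bigr => l _.
by rewrite /link_time (equilibrium_link_flow_unique beta0 uG eh eg).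
Qed.

Lemma T_EqE G Q h T : (forall l, 0 < beta l) -> all uniq G -> 0 < Q ->
  is_equilibrium alpha beta G Q h T -> T_Eq alpha beta G Q = T.
Proof.
move=> beta0 uG Q0 eh; apply: xget_unique; first by exists h.
move=> U [g eg]; apply/le_anti/andP.
by split; [apply: equilibrium_time_le eg eh | apply: equilibrium_time_le eh eg].
Qed.

(** * Equilibria given by explicit path flows *)

Definition flow_of (x y z : R) (p : seq link) : R :=
  if p == P1 then x else if p == P2 then y else z.

(** Equilibrium condition on one path with flow [x] and time [t]. The inequality is also asked of a
    used path, where the equality implies it. *)
Definition wardrop (x t T : R) : Prop := T <= t /\ (x != 0 -> t = T).

Lemma T_Eq_N Q x y T : (forall l, 0 < beta l) -> 0 < Q ->
  0 <= x -> 0 <= y -> x + y = Q ->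
  wardrop x (alpha ab + beta ab * x + (alpha bd + beta bd * x)) T ->
  wardrop y (alpha ac + beta ac * y + (alpha cd + beta cd * y)) T ->
  T_Eq alpha beta N Q = T.
Proof.
move=> beta0 Q0 x0 y0 xyQ [le1 eq1] [le2 eq2].
apply: (T_EqE (h := flow_of x y 0)) => //; split; first split.
- by move=> p; rewrite !inE => /orP[]/eqP->.
- by rewrite /N /= !big_cons big_nil /= addr0.
move=> p; rewrite !inE => /orP[]/eqP->;
  rewrite /path_time !big_cons big_nil /link_time /link_flow !big_cons !big_nil
    /= !addr0; by split.
Qed.

Lemma T_Eq_Nplus Q x y z T : (forall l, 0 < beta l) -> 0 < Q ->
  0 <= x -> 0 <= y -> 0 <= z -> x + y + z = Q ->
  wardrop x (alpha ab + beta ab * (x + z) + (alpha bd + beta bd * x)) T ->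
  wardrop y (alpha ac + beta ac * y + (alpha cd + beta cd * (y + z))) T ->
  wardrop z (alpha ab + beta ab * (x + z) +
    (alpha bc + beta bc * z + (alpha cd + beta cd * (y + z)))) T ->
  T_Eq alpha beta Nplus Q = T.
Proof.
move=> beta0 Q0 x0 y0 z0 xyQ [le1 eq1] [le2 eq2] [le3 eq3].
apply: (T_EqE (h := flow_of x y z)) => //; split; first split.
- by move=> p; rewrite !inE => /or3P[]/eqP->.
- by rewrite !big_cons big_nil /= addr0 addrA.
move=> p; rewrite !inE => /or3P[]/eqP->;
  rewrite /path_time !big_cons big_nil /link_time /link_flow !big_cons !big_nil
    /= !addr0; by split.
Qed.

Lemma T_Eq_bridge_unused Q x y T : (forall l, 0 < beta l) -> 0 < Q ->
  0 <= x -> 0 <= y -> x + y = Q ->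
  wardrop x (alpha ab + beta ab * x + (alpha bd + beta bd * x)) T ->
  wardrop y (alpha ac + beta ac * y + (alpha cd + beta cd * y)) T ->
  T <= alpha ab + beta ab * x + (alpha bc + (alpha cd + beta cd * y)) ->
  T_Eq alpha beta Nplus Q = T_Eq alpha beta N Q.
Proof.
move=> beta0 Q0 x0 y0 xyQ w1 w2 le3.
rewrite (@T_Eq_N Q x y T)//; apply: (@T_Eq_Nplus Q x y 0 T) => //;
  rewrite ?mulr0 ?addr0//.
by split => //; rewrite eqxx.
Qed.

(** * Intervals of total flow ending at [Q] *)

Lemma pseudo_paradox_at_le Q m : 0 <= m -> m < Q ->
  (forall q : R, m < q -> q <= Q -> T_Eq alpha beta Nplus q = T_Eq alpha beta N q) ->
  pseudo_paradox_at alpha beta Q.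
Proof.
(* The left end is excluded so that [m = 0] is allowed although total flows must be positive. *)
move=> m0 mQ eqT; exists `]m, Q]; split; first by rewrite in_itv /= mQ lexx.
  by exists ((m + Q) / 2), Q; split; rewrite ?in_itv/=; lra.
move=> q; rewrite in_itv /= => /andP[mq qQ].
by split; [exact: le_lt_trans mq | exact: eqT].
Qed.

Lemma pseudo_paradox_at_ge Q : 0 < Q ->
  (forall q : R, Q <= q -> T_Eq alpha beta Nplus q = T_Eq alpha beta N q) ->
  pseudo_paradox_at alpha beta Q.
Proof.
move=> Q0 eqT; exists `[Q, +oo[; split; first by rewrite in_itv /= lexx.
  by exists Q, (Q + 1); split; rewrite ?in_itv/=; lra.
move=> q; rewrite in_itv /= andbT => Qq.
by split; [exact: lt_le_trans Qq | exact: eqT].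
Qed.

End EquilibriumTime.

(** * The four conditions on the parameters *)

Theorem corollary4 (R : realType)
    (alpha1 alpha2 alpha3 alpha4 alpha5 beta1 beta2 beta3 beta4 beta5 Q : R)
    (halpha1 : 0 <= alpha1) (halpha2 : 0 <= alpha2) (halpha3 : 0 <= alpha3)
    (halpha4 : 0 <= alpha4) (halpha5 : 0 <= alpha5)
    (hbeta1 : 0 < beta1) (hbeta2 : 0 < beta2) (hbeta3 : 0 < beta3)
    (hbeta4 : 0 < beta4) (hbeta5 : 0 < beta5) (hQ : 0 < Q) :
  let beta12 := beta1 + beta2 in
  let beta14 := beta1 + beta4 in
  let beta25 := beta2 + beta5 in
  let beta45 := beta4 + beta5 in
  let alpha := (alpha4 + alpha5) - (alpha1 + alpha2) in
  let alpha_bar := alpha4 - (alpha1 + alpha3) in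
  let alpha_hat := alpha2 - (alpha3 + alpha5) in
  let B1 := beta1 * beta5 - beta2 * beta4 in
  let mu1 := (alpha_hat * beta14 - alpha * beta3)
             / (beta3 * beta45 + beta5 * beta14) in
  let mu2 := (alpha_bar * beta25 + alpha * beta3)
             / (beta1 * beta25 + beta3 * beta12) in
  [\/ 0 < Q /\ Q <= Num.min (- alpha / beta45) (- alpha_bar / beta4),
      0 < Q /\ Q <= Num.min (alpha / beta12) (- alpha_hat / beta2),
      Num.max (alpha / beta12) (- alpha / beta45) < Q /\
      alpha_hat * beta14 + alpha_bar * beta25 <= Q * B1 |
      [/\ B1 = 0,
          0 < alpha_hat * beta14 + alpha_bar * beta25 &
          Num.max (Num.max (alpha / beta12) (- alpha / beta45))
                  (Num.max mu1 mu2) < Q]] ->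
  pseudo_paradox_at (by_link alpha1 alpha2 alpha3 alpha4 alpha5)
                    (by_link beta1 beta2 beta3 beta4 beta5) Q.
Proof.
move=> beta12 beta14 beta25 beta45 alpha alpha_bar alpha_hat B1 mu1 mu2.
have b0 l : 0 < by_link beta1 beta2 beta3 beta4 beta5 l by case: l.
have beta12_gt0 : 0 < beta1 + beta2 by exact: addr_gt0.
have beta14_gt0 : 0 < beta1 + beta4 by exact: addr_gt0.
have beta25_gt0 : 0 < beta2 + beta5 by exact: addr_gt0.
have beta45_gt0 : 0 < beta4 + beta5 by exact: addr_gt0.
have S_gt0 : 0 < beta1 + beta2 + (beta4 + beta5) by exact: addr_gt0.
have S_neq0 := lt0r_neq0 S_gt0.
(* Equating the times of a-b-d and a-c-d in [N], with [x + y = q], gives this equation for [x]; the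
   two bounds on [q] make both flows nonnegative. *)
have N_split (q : R) : Num.max (alpha / beta12) (- alpha / beta45) < q ->
    exists x y : R, [/\ 0 <= x, 0 <= y, x + y = q &
      x * (beta12 + beta45) = alpha + beta45 * q].
  rewrite gt_max !ltr_pdivrMr// => /andP[lt1 lt2].
  exists ((alpha + beta45 * q) / (beta12 + beta45)).
  exists ((beta12 * q - alpha) / (beta12 + beta45)).
  rewrite !divr_ge0 ?(ltW S_gt0)//; [split => //| lra | lra].
    by rewrite -mulrDl; apply/(canLR (mulfK S_neq0)); rewrite /beta12 /beta45; ring.
  by rewrite divfK.
case=> [[_]|[_]|[maxQ KQ]|[B1_eq0 K_gt0]].
(* All traffic takes a-c-d; the two bounds say that neither a-b-d nor a-b-c-d is faster. *)
- rewrite le_min !ler_pdivlMr// => /andP[Qa Qb].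
  apply: (@pseudo_paradox_at_le _ _ _ _ 0) => // q q_gt0 qQ.
  have qa : q * beta45 <= - alpha by apply: le_trans Qa; rewrite ler_pM2r.
  have qb : q * beta4 <= - alpha_bar by apply: le_trans Qb; rewrite ler_pM2r.
  subst beta12 beta14 beta25 beta45 alpha alpha_bar alpha_hat B1 mu1 mu2.
  apply: (@T_Eq_bridge_unused _ _ _ _ 0 q
    (alpha4 + beta4 * q + (alpha5 + beta5 * q))) => //=;
    rewrite ?add0r ?(ltW q_gt0)//; rewrite /wardrop ?eqxx ?mulr0; try split => //; lra.
(* Symmetrically, all traffic takes a-b-d. *)
- rewrite le_min !ler_pdivlMr// => /andP[Qa Qb].
  apply: (@pseudo_paradox_at_le _ _ _ _ 0) => // q q_gt0 qQ.
  have qa : q * beta12 <= alpha by apply: le_trans Qa; rewrite ler_pM2r.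
  have qb : q * beta2 <= - alpha_hat by apply: le_trans Qb; rewrite ler_pM2r.
  subst beta12 beta14 beta25 beta45 alpha alpha_bar alpha_hat B1 mu1 mu2.
  apply: (@T_Eq_bridge_unused _ _ _ _ q 0
    (alpha1 + beta1 * q + (alpha2 + beta2 * q))) => //=;
    rewrite ?addr0 ?(ltW q_gt0)//; rewrite /wardrop ?eqxx ?mulr0; try split => //; lra.
- have eqT (q : R) : Num.max (alpha / beta12) (- alpha / beta45) < q -> 0 < q ->
      alpha_hat * beta14 + alpha_bar * beta25 <= q * B1 ->
      T_Eq (by_link alpha1 alpha2 alpha3 alpha4 alpha5)
           (by_link beta1 beta2 beta3 beta4 beta5) Nplus q =
      T_Eq (by_link alpha1 alpha2 alpha3 alpha4 alpha5)
           (by_link beta1 beta2 beta3 beta4 beta5) N q.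
    move=> /N_split[x [y [x_ge0 y_ge0 <- xS]]] q_gt0 Kq.
    have xS' := congr1 ( *%R beta25) xS.
    (* The first factor is the time on a-b-c-d minus that on a-b-d; the product equals [(x + y) * B1
       - (alpha_hat * beta14 + alpha_bar * beta25)]. *)
    have: 0 <= (beta5 * y - beta2 * x - alpha_hat) * (beta12 + beta45).
      subst beta12 beta14 beta25 beta45 alpha alpha_bar alpha_hat B1 mu1 mu2.
      lra.
    rewrite pmulr_lge0// => le3.
    subst beta12 beta14 beta25 beta45 alpha alpha_bar alpha_hat B1 mu1 mu2.
    by apply: (@T_Eq_bridge_unused _ _ _ _ x y
      (alpha1 + beta1 * x + (alpha2 + beta2 * x))) => //=;
      rewrite /wardrop; try split=> *; lra.
  (* The sign of [B1] decides whether the condition persists for larger or for smaller total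
     flows. *)
  have [B1_ge0 | B1_lt0] := leP 0 B1.
    apply: pseudo_paradox_at_ge => // q Qq; apply: eqT.
    - exact: lt_le_trans Qq.
    - exact: lt_le_trans Qq.
    - by apply: le_trans KQ _; rewrite ler_wpM2r.
  apply: (@pseudo_paradox_at_le _ _ _ _
    (Num.max 0 (Num.max (alpha / beta12) (- alpha / beta45)))) => [||q].
  - by rewrite le_max lexx.
  - by rewrite gt_max hQ.
  rewrite gt_max => /andP[q_gt0 maxq] qQ; apply: eqT => //.
  by apply: le_trans KQ _; rewrite ler_nM2r.
- set K := _ + _ in K_gt0.
  move: B1_eq0; rewrite gt_max => B1_eq0 /andP[maxQ].
  (* Determinant of the equal-time equations in [x] and [y], once [z] is replaced by [q - x - y]. *)
  pose M := beta14 * beta25 + beta3 * (beta14 + beta25).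
  have M_gt0 : 0 < M by rewrite addr_gt0 ?mulr_gt0 ?addr_gt0.
  have M_neq0 := lt0r_neq0 M_gt0.
  rewrite gt_max !ltr_pdivrMr ?addr_gt0 ?mulr_gt0// => /andP[mu1Q mu2Q].
  apply: pseudo_paradox_at_ge => // q Qq.
  have q_gt0 : 0 < q by exact: lt_le_trans Qq.
  have [u [v [u_ge0 v_ge0 uvq uS]]] := N_split q (lt_le_trans maxQ Qq).
  (* Solution of the linear system expressing that the three paths of [Nplus]
     have equal times, simplified using [B1 = 0]. *)
  pose x := ((beta3 * beta45 + beta5 * beta14) * q
    - (alpha_hat * beta14 - alpha * beta3)) / M.
  pose y := ((beta1 * beta25 + beta3 * beta12) * q
    - (alpha_bar * beta25 + alpha * beta3)) / M.
  pose z := K / M.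
  have xM : x * M = (beta3 * beta45 + beta5 * beta14) * q
    - (alpha_hat * beta14 - alpha * beta3) by rewrite divfK.
  have yM : y * M = (beta1 * beta25 + beta3 * beta12) * q
    - (alpha_bar * beta25 + alpha * beta3) by rewrite divfK.
  have zM : z * M = K by rewrite divfK.
  (* [mu1] and [mu2] are the total flows at which [x] and [y] vanish. *)
  have x_ge0 : 0 <= x.
    apply: divr_ge0; last exact: ltW.
    rewrite subr_ge0; apply: le_trans (ltW mu1Q) _.
    by rewrite mulrC ler_wpM2l// ltW// addr_gt0 ?mulr_gt0.
  have y_ge0 : 0 <= y.
    apply: divr_ge0; last exact: ltW.
    rewrite subr_ge0; apply: le_trans (ltW mu2Q) _.
    by rewrite mulrC ler_wpM2l// ltW// addr_gt0 ?mulr_gt0.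
  have z_ge0 : 0 <= z by rewrite divr_ge0// ltW.
  clearbody x y z.
  have B1_mul t : t * B1 = 0 by rewrite B1_eq0 mulr0.
  (* Over [M], the flow left by [x] and [y] has numerator [K - q * B1], so [B1 = 0] makes it
     independent of [q]. *)
  have zE : z = q - x - y.
    apply: (mulIf M_neq0); rewrite !mulrBl zM xM yM; have := B1_mul q.
    subst K M beta12 beta14 beta25 beta45 alpha alpha_bar alpha_hat B1 mu1 mu2.
    lra.
  (* The left side is the time on a-b-c-d minus that on a-b-d; in [time23], minus that on a-c-d. *)
  have time13 : beta3 * z - alpha_hat - beta25 * x + beta5 * q = 0.
    apply: (mulIf M_neq0); rewrite mul0r; have := B1_mul (beta3 * q).
    have := congr1 ( *%R beta3) zM; have := congr1 ( *%R beta25) xM.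
    clear mu1Q mu2Q xM yM zM uS zE.
    subst K M beta12 beta14 beta25 beta45 alpha alpha_bar alpha_hat B1 mu1 mu2.
    lra.
  have time23 : beta3 * z - alpha_bar - beta14 * y + beta1 * q = 0.
    apply: (mulIf M_neq0); rewrite mul0r; have := B1_mul (beta3 * q).
    have := congr1 ( *%R beta3) zM; have := congr1 ( *%R beta14) yM.
    clear mu1Q mu2Q xM yM zM uS zE time13.
    subst K M beta12 beta14 beta25 beta45 alpha alpha_bar alpha_hat B1 mu1 mu2.
    lra.
  (* The time on a-b-d is the same in both networks: multiplied by [beta12 + beta45], the two sides
     differ by a multiple of [B1 * z]. *)
  have bridge_time : beta12 * u = beta12 * x + beta1 * z.
    apply: (mulIf S_neq0); have := B1_mul z.
    have := congr1 ( *%R beta12) uS.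
    have := congr1 ( *%R beta12) time13; have := congr1 ( *%R beta12) time23.
    clear mu1Q mu2Q xM yM zM uS time13 time23; rewrite zE.
    subst K M beta12 beta14 beta25 beta45 alpha alpha_bar alpha_hat B1 mu1 mu2.
    lra.
  clear mu1Q mu2Q xM yM zM; clear K M K_gt0 M_gt0 M_neq0.
  have {uvq} vE : v = q - u by rewrite -uvq; ring.
  subst z v.
  subst beta12 beta14 beta25 beta45 alpha alpha_bar alpha_hat B1 mu1 mu2.
  pose T := alpha1 + beta1 * u + (alpha2 + beta2 * u).
  rewrite (@T_Eq_Nplus _ _ _ q x y (q - x - y) T)//=; last 4 first.
  - by lra.
  - by rewrite /wardrop /T; split=> *; lra.
  - by rewrite /wardrop /T; split=> *; lra.
  - by rewrite /wardrop /T; split=> *; lra.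
  rewrite (@T_Eq_N _ _ _ q u (q - u) T)//=; rewrite /wardrop /T.
  - lra.
  - by split=> *; lra.
Qed.
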